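(* Let $\mathcal{E}_{\mathrm P}=\{p_\theta:\theta\in\Theta\}$ be a discrete exponential family on $\mathbb{R}^k$ with base measure $\nu$ and convex support $\mathrm P$ satisfying assumptions (A1)-(A4) of the context. Let $F$ be a face of $\mathrm P$, let $\theta\in\Theta$, and let $\theta_F=\{\theta+\zeta\in\Theta:\zeta\in\mathrm{lin}(N_F)\}$. Let $\{\theta_n\}\subset\Theta$ be a sequence of the form $\theta_n=\eta+\rho_n d_n$, where $\{\rho_n\}$ is a sequence of non-negative scalars tending to infinity, $\eta\in\theta_F$, and $\{d_n\}\subset\mathbb{R}^k$ is a sequence of unit vectors (Euclidean norm). Put $\mu_n=\mathbb{E}_{\theta_n}[X]$ and consider the statement $$(\ast)\qquad p_{\theta_n}\to p^F_{\theta_F}\ \ \nu\text{-a.e.}\quad\text{and}\quad \mu_n\to\mu^F\in\mathrm{relint}(F),$$ where $\mu^F$ is the mean of the distribution with $\nu_F$-density $p^F_{\theta_F}$. 1. If $\{d_n\}\subset R$ for some compact subset $R$ of $\mathrm{relint}(N_F)$, then $(\ast)$ holds. 2. If $\{d_n\}\subset R$ for some compact subset $R$ of $\mathbb{R}^k\setminus N_F$, then $(\ast)$ fails. 3. If $\{d_n\}\subset R$ for some compact subset $R$ of $\mathbb{R}^k\setminus\bigcup_{G}N_G$, the union being over all faces $G$ of $\mathrm P$, then $\|\mu_n\|_2\to\infty$ (which, in particular, implies that $(\ast)$ does not hold).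
   Context: Setting. $\nu$ is a measure on $\mathbb{R}^k$ concentrated on its support $\mathrm{supp}(\nu)=$ closure of $\{x:\nu(\{x\})>0\}$. The convex support $\mathrm P$ is the closure of the convex hull of $\mathrm{supp}(\nu)$. The densities with respect to $\nu$ are $p_\theta(x)=\exp\{\langle x,\theta\rangle-\psi(\theta)\}$, $\psi(\theta)=\log\int e^{\langle x,\theta\rangle}d\nu(x)$, $\theta\in\Theta$, where $\emptyset\ne\Theta\subseteq\{\theta\in\mathbb{R}^k:\int e^{\langle x,\theta\rangle}d\nu(x)<\infty\}$. $\mathbb{E}_\theta[X]=\int z\,p_\theta(z)\,d\nu(z)$. Assumptions. (A1) $\mathrm{supp}(\nu)$ is countable. (A2) $\mathrm P$ is a full-dimensional polyhedron in $\mathbb{R}^k$. (A3) Every face $F$ of $\mathrm P$ satisfies $F=\mathrm{convhull}(S_F)$ for some set $S_F$ of points $x$ with $\nu(\{x\})>0$. (A4) $\Theta$ is open. Faces are nonempty; $\mathrm P$ is regarded as the improper face of itself. $\mathrm{relint}$ denotes relative interior. For a face $F$, $\nu_F$ is the restriction of $\nu$ to $F$, and $p^F_\theta(x)=\exp\{\langle x,\theta\rangle-\psi^F(\theta)\}$ for $x\in F$, $p^F_\theta(x)=0$ for $x\notin F$, where $\psi^F(\theta)=\log\int e^{\langle x,\theta\rangle}d\nu_F(x)$; the function $p^F_\theta$ depends ($\nu$-a.e.) only on the class $\theta_F$ and is written $p^F_{\theta_F}$. Normal cone: $N_F=\{c\in\mathbb{R}^k: F\subseteq\{x\in\mathrm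 P:\langle c,x\rangle=\max_{y\in\mathrm P}\langle c,y\rangle\}\}$. $\mathrm{lin}(N_F)$ is the linear span of $N_F$. *)

(* Defs.v *)
From HB Require Import structures.
From mathcomp Require Import all_boot all_order all_algebra.
From mathcomp Require Import all_classical all_reals all_analysis.

Set Implicit Arguments.
Unset Strict Implicit.
Unset Printing Implicit Defensive.

Import Order.TTheory GRing.Theory Num.Theory.
Import numFieldNormedType.Exports.

Local Open Scope classical_set_scope.
Local Open Scope ring_scope.

Definition dot (R : realType) (k : nat) (x y : 'rV[R]_k) : R :=
  \sum_(i < k) x 0 i * y 0 i.

(* The library norm on 'rV[R]_k is the sup norm. *)
Definition norm2 (R : realType) (k : nat) (x : 'rV[R]_k) : R :=
  Num.sqrt (dot x x).

Section ConvexGeometry.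
Variables (R : realType) (k : nat).
Implicit Types (A P F : set 'rV[R]_k) (c x y : 'rV[R]_k).

Definition linear_span A : set 'rV[R]_k :=
  [set x | exists m (a : 'I_m -> R) (v : 'I_m -> 'rV[R]_k),
    (forall i, A (v i)) /\ x = \sum_(i < m) a i *: v i].

Definition affine_hull A : set 'rV[R]_k :=
  [set x | exists m (a : 'I_m -> R) (v : 'I_m -> 'rV[R]_k),
    [/\ forall i, A (v i), \sum_(i < m) a i = 1
      & x = \sum_(i < m) a i *: v i]].

Definition convex_hull A : set 'rV[R]_k :=
  [set x | exists m (a : 'I_m -> R) (v : 'I_m -> 'rV[R]_k),
    [/\ forall i, A (v i), forall i, 0 <= a i, \sum_(i < m) a i = 1
      & x = \sum_(i < m) a i *: v i]].

Definition relint A : set 'rV[R]_k :=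
  [set x | A x /\ \forall y \near x, affine_hull A y -> A y].

Definition polyhedron P : Prop :=
  exists m (a : 'I_m -> 'rV[R]_k) (b : 'I_m -> R),
    P = [set x | forall i, dot (a i) x <= b i].

Definition full_dimensional P : Prop := affine_hull P = [set: 'rV[R]_k].

(* Empty when the linear form [dot c] has no maximum on P. *)
Definition argmax_set P c : set 'rV[R]_k :=
  [set x | P x /\ forall y, P y -> dot c y <= dot c x].

(* The vector c = 0 makes P a face of itself. *)
Definition face P F : Prop := F !=set0 /\ exists c, F = argmax_set P c.

Definition normal_cone P F : set 'rV[R]_k :=
  [set c | F `<=` argmax_set P c].

End ConvexGeometry.

Notation borel_rV R k := (g_sigma_algebraType (@open 'rV[R]_k)).

Section ExponentialFamily.
Variables (R : realType) (k : nat).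
Variable nu : {measure set (borel_rV R k) -> \bar R}.
Implicit Types (Theta A F : set 'rV[R]_k) (theta x : 'rV[R]_k).

Definition atoms : set 'rV[R]_k := [set x | (0 < nu [set x])%E].

Definition supp : set 'rV[R]_k := closure atoms.

Definition convex_support : set 'rV[R]_k := closure (convex_hull supp).

Definition natural_parameters : set 'rV[R]_k :=
  [set theta | (\int[nu]_x (expR (dot x theta))%:E < +oo)%E].

(* The next three definitions concern the restriction of nu to A:
   A = setT gives psi, p_theta and E_theta[X], and A = F gives psi^F,
   p^F_theta and mu^F. *)
Definition log_partition A theta : R :=
  ln (\int[nu]_(x in A) expR (dot x theta)).

Definition density A theta x : R :=
  if x \in A then expR (dot x theta - log_partition A theta) else 0.

Definition mean A theta : 'rV[R]_k :=
  \row_i \int[nu]_(x in A) (x 0 i * density A theta x).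

Record discrete_exponential_family Theta : Prop := {
  nu_concentrated : nu (~` supp) = 0%E;
  Theta_nonempty : Theta !=set0;
  Theta_natural : Theta `<=` natural_parameters;
  supp_countable : countable supp;
  convex_support_polyhedron : polyhedron convex_support;
  convex_support_full_dimensional : full_dimensional convex_support;
  faces_convex_hull : forall F, face convex_support F ->
    exists S, S `<=` atoms /\ F = convex_hull S;
  Theta_open : open Theta }.

(* This is theta_F. *)
Definition parameter_class Theta F theta : set 'rV[R]_k :=
  [set eta | Theta eta /\ exists zeta,
    linear_span (normal_cone convex_support F) zeta /\ eta = theta + zeta].

(* The a.e. class of density F theta depends only on parameter_class Theta F
   theta, so theta serves as the representative of that class. *)
Definition converges_to_face F theta (theta_ : nat -> 'rV[R]_k) : Prop :=
  [/\ {ae nu, forall x,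
        (fun n => density setT (theta_ n) x) @ \oo --> density F theta x},
      (fun n => mean setT (theta_ n)) @ \oo --> mean F theta
    & relint F (mean F theta)].

End ExponentialFamily.

(* Main.v *)
(* With f a point of F, rescale e^<x, theta_n> to
   w_n(x) = e^(<x, eta> + rho_n <d_n, x - f>).
   Part 1: directions in relint(N_F) are maximized over P exactly on F, so
   <d_n, x - f> vanishes on F and is bounded above by a negative number,
   uniformly in n, for each x of P outside F. Hence w_n converges pointwise to
   e^<x, eta> 1_F and is dominated by e^<x, eta> on P; as Theta is open, the
   first moments are dominated too, and dominated convergence gives both limits.
   Part 2: for a cluster point d of (d_n), d is not in N_F, so there are atoms
   s in F and t in P with <d, t> > <d, s>, and the ratio of the densities at t
   and s is unbounded.
   Part 3: by Jensen's inequality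
   rho_n <d_n, mu_n> >= psi(theta_n) - psi(eta) >= rho_n <d_n, x> + const(x)
   for every atom x, so |mu_n| is asymptotically at least <d_n, x>; a linear
   form with no maximum on the polyhedron P is unbounded on the atoms. *)

Require Import Defs.
From HB Require Import structures.
From mathcomp Require Import all_boot all_order all_algebra.
From mathcomp Require Import all_classical all_reals all_analysis.
From mathcomp Require Import measurable_realfun ring lra.

Set Implicit Arguments.
Unset Strict Implicit.
Unset Printing Implicit Defensive.

Import Order.TTheory GRing.Theory Num.Theory.
Import numFieldNormedType.Exports.

Local Open Scope classical_set_scope.
Local Open Scope ring_scope.

(** * The Euclidean inner product *)

Section Dot.
Variables (R : realType) (k : nat).
Implicit Types x y z : 'rV[R]_k.

Lemma dotC x y : dot x y = dot y x.
Proof. by apply: eq_bigr => i _; rewrite mulrC. Qed.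

Lemma dotDr x y z : dot x (y + z) = dot x y + dot x z.
Proof. by rewrite -big_split; apply: eq_bigr => i _; rewrite mxE mulrDr. Qed.

Lemma dotZr x a y : dot x (a *: y) = a * dot x y.
Proof. by rewrite mulr_sumr; apply: eq_bigr => i _; rewrite mxE mulrCA. Qed.

Lemma dot0r x : dot x 0 = 0.
Proof. by rewrite -(scale0r 0) dotZr mul0r. Qed.

Lemma dotNr x y : dot x (- y) = - dot x y.
Proof. by rewrite -scaleN1r dotZr mulN1r. Qed.

Lemma dotBr x y z : dot x (y - z) = dot x y - dot x z.
Proof. by rewrite dotDr dotNr. Qed.

Lemma dotDl x y z : dot (x + y) z = dot x z + dot y z.
Proof. by rewrite dotC dotDr !(dotC z). Qed.

Lemma dotZl a x y : dot (a *: x) y = a * dot x y.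
Proof. by rewrite dotC dotZr dotC. Qed.

Lemma dotBl x y z : dot (x - y) z = dot x z - dot y z.
Proof. by rewrite dotC dotBr !(dotC z). Qed.

Lemma dot_sumr x m (v : 'I_m -> 'rV[R]_k) :
  dot x (\sum_(i < m) v i) = \sum_(i < m) dot x (v i).
Proof. by apply: (big_morph _ (dotDr x) (dot0r x)). Qed.

Lemma dotrr_ge0 x : 0 <= dot x x.
Proof. by apply: sumr_ge0 => i _; rewrite -expr2 sqr_ge0. Qed.

(** Cauchy-Schwarz: for a unit vector [x], the squared length of [y - dot x y *: x] is
    [dot y y - dot x y ^+ 2]. *)
Lemma dot_unit_le x y : norm2 x = 1 -> dot x y <= norm2 y.
Proof.
move=> x1; have xx1 : dot x x = 1.
  by rewrite -(sqr_sqrtr (dotrr_ge0 x)) -/(norm2 x) x1 expr1n.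
apply: (le_trans (ler_norm _)); rewrite -sqrtr_sqr ler_sqrt ?dotrr_ge0//.
rewrite -subr_ge0; have := dotrr_ge0 (y - dot x y *: x).
rewrite dotBr !dotBl !dotZr !dotZl xx1 (dotC y x).
by rewrite mulr1 subrr subr0 expr2.
Qed.

Lemma dot_continuousl y : continuous (fun x => dot x y).
Proof.
apply: continuous_big => [|i _ x]; first exact: add_continuous.
exact: cvgM (@coord_continuous R 1 k 0 i x) (cvg_cst (y 0 i)).
Qed.

Lemma dot_continuousr x : continuous (fun y => dot x y).
Proof.
by rewrite (_ : dot x = fun y => dot y x); [exact: dot_continuousl |
  apply/funext => y; exact: dotC].
Qed.

End Dot.

(** * Convex hulls, faces and normal cones *)

Section Convexity.
Variables (R : realType) (k : nat).
Implicit Types (A P F S : set 'rV[R]_k) (c x y : 'rV[R]_k).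

Lemma sub_convex_hull A : A `<=` convex_hull A.
Proof.
move=> x Ax; exists 1%N, (fun=> 1), (fun=> x).
by split=> //; rewrite big_ord1 ?scale1r.
Qed.

Lemma convex_hull_affine A : convex_hull A `<=` affine_hull A.
Proof. by move=> x [m [a [v [Av _ a1 ->]]]]; exists m, a, v. Qed.

Lemma affine_hull_dot_eq A c (b : R) x :
  (forall y, A y -> dot c y = b) -> affine_hull A x -> dot c x = b.
Proof.
move=> Ab [m [a [v [Av a1 ->]]]]; rewrite dot_sumr.
under eq_bigr do rewrite dotZr Ab//.
by rewrite -mulr_suml a1 mul1r.
Qed.

(** If every gap [dot c x - dot c (v i)] were positive, their weighted sum, which is 0, would force
    all weights to vanish, although they sum to 1. This allows points of [P] or of a face to be
    replaced by atoms. *)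
Lemma convex_hull_dot_le A c x :
  convex_hull A x -> exists2 s, A s & dot c x <= dot c s.
Proof.
move=> [m [a [v [Av a0 a1 ->]]]]; apply: contrapT => Hn.
have lt_c i : dot c (v i) < dot c (\sum_(j < m) a j *: v j).
  by rewrite ltNge; apply/negP => ?; apply: Hn; exists (v i).
set b := dot c _ in lt_c.
have sum0 : \sum_(i < m) a i * (b - dot c (v i)) = 0.
  under eq_bigr do rewrite mulrBr.
  rewrite sumrB -mulr_suml a1 mul1r {1}/b dot_sumr.
  by under eq_bigr do rewrite dotZr; rewrite subrr.
have ai0 i : a i = 0.
  have /eqP := sum0; rewrite psumr_eq0.
    move=> /allP/(_ i (mem_index_enum _)) /=.
    by rewrite mulf_eq0 subr_eq0 (gt_eqF (lt_c i)) orbF => /eqP.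
  by move=> j _; rewrite mulr_ge0// subr_ge0 ltW.
by move/eqP: a1; under eq_bigr do rewrite ai0; rewrite big1// eq_sym oner_eq0.
Qed.

Lemma convex_hull_dot_ge A c x :
  convex_hull A x -> exists2 s, A s & dot c s <= dot c x.
Proof.
move=> /(@convex_hull_dot_le _ (- c) _)[s As].
by rewrite dotC dotNr (dotC (- c)) dotNr lerN2 !(dotC _ c) => ?; exists s.
Qed.

Lemma face_improper P : P !=set0 -> face P P.
Proof.
move=> P0; split=> //; exists 0.
apply/seteqP; split=> [x Px|x []//]; split=> // y _.
by rewrite !(dotC 0) !dot0r.
Qed.

Lemma normal_coneP P F c :
  F `<=` P -> ~ normal_cone P F c ->
  exists x y, [/\ F x, P y & dot c x < dot c y].
Proof.
move=> FP /existsNP[x /not_implyP[Fx]] /not_andP[//|/existsNP[y]].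
  by move=> /(_ (FP _ Fx)).
by move=> /not_implyP[Py] /negP; rewrite -ltNge => ?; exists x, y.
Qed.

(* [c] can be pushed slightly away from a direction [c0] exposing [F] without
   leaving the normal cone, so every maximizer of [c] also maximizes [c0]. *)
Lemma relint_normal_cone_argmax P F c :
  face P F -> relint (normal_cone P F) c -> argmax_set P c = F.
Proof.
move=> [[f Ff] [c0 Fc0]] [cN].
have c0N : normal_cone P F c0 by rewrite /normal_cone /= -Fc0.
move=> near_c; apply/seteqP; split=> // x [Px xmax].
(* The segment from [c0] to [c] is prolonged beyond [c]; the coefficients [1 + e] and [- e] sum to
   1. *)
have line_aff (e : R) : affine_hull (normal_cone P F) (c + e *: (c - c0)).
  exists 2%N, (fun i => if i == ord0 then 1 + e else - e),
    (fun i => if i == ord0 then c else c0); split.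
  - by move=> i; case: ifP.
  - by rewrite !big_ord_recl big_ord0 /= addr0 addrK.
  - rewrite !big_ord_recl big_ord0 /= addr0 scalerDl scale1r scalerBr scaleNr.
    by rewrite addrA.
have line_cvg : (c + e *: (c - c0)) @[e --> (0 : R)] --> c.
  suff : (c + e *: (c - c0)) @[e --> (0 : R)] --> c + 0 *: (c - c0).
    by rewrite scale0r addr0.
  by apply: cvgD; [exact: cvg_cst | apply: cvgZr_tmp; exact: cvg_id].
have [e /= e0 eN] : exists2 e : R, 0 < e & normal_cone P F (c + e *: (c - c0)).
  have near0 : \forall e \near (0 : R)^'+,
      affine_hull (normal_cone P F) (c + e *: (c - c0)) ->
      normal_cone P F (c + e *: (c - c0)).
    exact: (cvg_at_right_filter line_cvg) near_c.
  have [e [e0 eN]] := filter_ex (filterI (nbhs_right_gt (0 : R)) near0).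
  by exists e => //; exact: eN.
have [Pf fmax] := eN f Ff.
have := fmax x Px; have [_ /(_ x Px) cxf] := cN f Ff.
have cfx := xmax f Pf.
have {cxf cfx} cE : dot c x = dot c f by apply/eqP; rewrite eq_le cxf cfx.
(* As [c] agrees at [x] and [f], comparing the prolonged form at these points leaves
   [- dot c0 x <= - dot c0 f]. *)
rewrite !dotDl !dotZl !dotBl cE lerD2l ler_pM2l// lerD2l lerN2 => c0fx.
rewrite Fc0; split=> // y Py; apply: le_trans c0fx.
by move: Ff; rewrite Fc0 => -[_]; apply.
Qed.

End Convexity.

(** * Linear forms bounded above on a polyhedron *)

Section LinearProgramming.
Variables (R : realType) (k : nat).
Implicit Types (P : set 'rV[R]_k) (c x y : 'rV[R]_k).

(* A non-maximal point can be moved along a direction that keeps its active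
   constraints tight until another constraint becomes active; at points where
   this is no longer possible the value of the form depends only on the active
   set, so only finitely many values remain. *)
Lemma polyhedron_attains_max P c (b : R) :
  polyhedron P -> P !=set0 -> (forall x, P x -> dot c x <= b) ->
  argmax_set P c !=set0.
Proof.
move=> [m [a [a0 PE]]] [x0 Px0] cb.
pose act x := [set i : 'I_m | dot (a i) x == a0 i]%SET.
pose stuck x := forall r, (forall i, i \in act x -> dot (a i) r = 0) ->
  dot c r <= 0.
have PP x : P x <-> forall i, dot (a i) x <= a0 i by rewrite PE.
(* A recession direction cannot increase [c]: at [x + t *: r] the form has the value [b + dot c r],
   which may not exceed [b]. *)
have ray x r : P x -> (forall i, dot (a i) r <= 0) -> dot c r <= 0.
  move=> Px ar; rewrite leNgt; apply/negP => cr.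
  pose t := (b - dot c x) / dot c r + 1.
  have t0 : 0 <= t by rewrite addr_ge0 ?divr_ge0 ?subr_ge0 ?cb// ltW.
  have /cb : P (x + t *: r).
    apply/PP => i; rewrite dotDr dotZr (le_trans _ ((PP x).1 Px i))// gerDl.
    by rewrite mulr_ge0_le0.
  rewrite dotDr dotZr mulrDl divfK ?gt_eqF// mul1r addrA (addrC (dot c x)).
  by rewrite subrK gerDl leNgt cr.
(* Induction on the number of inactive constraints: each move activates at least one more. *)
have improve n : forall x, P x -> (#|~: act x| < n)%N ->
    exists y, [/\ P y, stuck y & dot c x <= dot c y].
  elim: n => // n IHn x Px xn.
  have [xs|/existsNP[r /not_implyP[ar /negP]]] := pselect (stuck x).
    by exists x.
  rewrite -ltNge => cr.
  pose blocking := [pred i | 0 < dot (a i) r].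
  pose step i := (a0 i - dot (a i) x) / dot (a i) r.
  have [/existsP[i0 bi0]|/existsPn noblock] := boolP [exists i, blocking i].
    (* The constraint [i] is the first one met along [r]. Stopping there stays in [P], keeps the
       active constraints tight and makes [i] active. *)
    case: (@Order.TotalTheory.arg_minP _ _ _ i0 blocking step bi0).
    move=> i bi min_i.
    have ti : 0 <= step i.
      by rewrite divr_ge0 ?subr_ge0 ?(ltW bi)//; exact: (PP x).1.
    have Py : P (x + step i *: r).
      apply/PP => j; rewrite dotDr dotZr; have := (PP x).1 Px j.
      have [bj|nbj xj] := boolP (blocking j).
        by move=> _; rewrite addrC -lerBrDr -ler_pdivlMr//; exact: min_i.
      rewrite (le_trans _ xj)// gerDl mulr_ge0_le0//.
      by rewrite leNgt.
    have [|y [? ? xy]] := IHn _ Py.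
      apply: (leq_trans _ (xn : #|_| <= n)%N); apply: proper_card.
      rewrite properC; apply/properP; split.
        apply/fintype.subsetP => j; rewrite !inE dotDr dotZr => jx.
        by rewrite ar ?inE// mulr0 addr0.
      exists i; rewrite !inE.
        by rewrite dotDr dotZr divfK ?lt0r_neq0// addrC subrK.
      by apply/negP => ix; move: bi; rewrite /= ar ?inE// ltxx.
    exists y; split=> //; apply: le_trans xy.
    by rewrite dotDr dotZr lerDl mulr_ge0// ltW.
  suff : dot c r <= 0 by rewrite leNgt cr.
  apply: (ray x) => // i.
  by rewrite leNgt noblock.
have {}improve x : P x -> exists y, [/\ P y, stuck y & dot c x <= dot c y].
  by move=> Px; exact: (improve #|~: act x|.+1).
(* With equal active sets, [y - x] is a direction keeping the active constraints of [x] tight, so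
   [stuck x] applies to it. *)
have stuck_eq x y : stuck x -> act x = act y -> dot c y <= dot c x.
  move=> xs xy; rewrite -subr_le0 -dotBr; apply: xs => i ix.
  move: (ix); rewrite xy; move: ix; rewrite !inE dotBr => /eqP -> /eqP ->.
  exact: subrr.
(* One stuck point is chosen for each active set that has one; [x0] is a dummy value for the others,
   which [good] excludes. The maximizer is the best of these finitely many points. *)
pose good A := `[< exists y, [/\ P y, stuck y & act y = A] >].
pose pt A := if pselect (exists y, [/\ P y, stuck y & act y = A]) is left h
  then projT1 (cid h) else x0.
have ptP A : good A -> [/\ P (pt A), stuck (pt A) & act (pt A) = A].
  by move=> /asboolP; rewrite /pt; case: pselect => // h _; case: cid.
have [y0 [Py0 y0s _]] := improve _ Px0.
have g0 : good (act y0) by apply/asboolP; exists y0.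
case: (@Order.TotalTheory.arg_maxP _ _ _ _ good (fun A => dot c (pt A)) g0).
move=> A gA maxA; exists (pt A); have [PA _ _] := ptP A gA; split=> // y Py.
have [z [Pz zs yz]] := improve _ Py; apply: (le_trans yz).
have gz : good (act z) by apply/asboolP; exists z.
have [_ ptzs ptz] := ptP _ gz.
by apply: le_trans (maxA _ gz); apply: stuck_eq.
Qed.

End LinearProgramming.

(** * Borel measurability, closedness of polyhedra, finite sums of integrals *)

Section BorelVectors.
Variables (R : realType) (k : nat).

Lemma continuous_measurable_rV (f : 'rV[R]_k -> R) :
  continuous f -> measurable_fun [set: borel_rV R k] f.
Proof.
move=> /continuousP cf.
apply: (measurability _ (RGenOpens.measurableE R)).
move=> _ [_ [a [b ->]] <-]; rewrite setTI; apply: sub_sigma_algebra.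
exact/cf/interval_open.
Qed.

Lemma closed_measurable_rV (A : set 'rV[R]_k) :
  closed A -> measurable (A : set (borel_rV R k)).
Proof.
move=> /closed_openC oA; rewrite -[A]setCK; apply: measurableC.
exact: sub_sigma_algebra.
Qed.

Lemma measurable_set1_rV (x : 'rV[R]_k) :
  measurable ([set x] : set (borel_rV R k)).
Proof.
apply: closed_measurable_rV; apply: accessible_closed_set1.
exact: hausdorff_accessible (@norm_hausdorff _ _).
Qed.

Lemma measurable_dot (u : 'rV[R]_k) :
  measurable_fun [set: borel_rV R k] (fun x => dot x u).
Proof. by apply: continuous_measurable_rV; exact: dot_continuousl. Qed.

Lemma measurable_expR_dot (u : 'rV[R]_k) :
  measurable_fun [set: borel_rV R k] (fun x => expR (dot x u)).
Proof.
apply: (measurableT_comp (@measurable_expR R)).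
exact: measurable_dot.
Qed.

Lemma dot_delta (x : 'rV[R]_k) i : dot x (delta_mx 0 i) = x 0 i.
Proof.
rewrite /dot (bigD1 i)//= mxE !eqxx mulr1 big1 ?addr0// => j ji.
by rewrite mxE (negPf ji) andbF mulr0.
Qed.

Lemma polyhedron_closed (P : set 'rV[R]_k) : polyhedron P -> closed P.
Proof.
move=> [m [a [b ->]]].
rewrite (_ : mkset _ = \bigcap_i [set x | dot (a i) x <= b i]).
  apply: closed_bigI => i _.
  have /continuous_closedP := @dot_continuousr R k (a i).
  by move=> /(_ [set r | r <= b i]); apply; exact: closed_le.
by apply/seteqP; split=> x /= xP i; [move=> _|]; exact: xP.
Qed.

Lemma polyhedron_face (P F : set 'rV[R]_k) :
  polyhedron P -> face P F -> polyhedron F.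
Proof.
move=> [m [a [b PE]]] [[f Ff] [c Fc]]; have := Ff; rewrite Fc => -[Pf fmax].
(* The inequality [dot c f <= dot c x], at index [ord0], is added to those of [P]. *)
exists m.+1, (fun i => if unlift ord0 i is Some j then a j else - c),
  (fun i => if unlift ord0 i is Some j then b j else - dot c f).
have dotNl x : dot (- c) x = - dot c x by rewrite dotC dotNr dotC.
apply/seteqP; split=> [x [Px xmax] i|x /= xP].
  case: unliftP => [j _|_]; first by move: Px; rewrite PE; exact.
  by rewrite dotNl lerN2 xmax.
have Px : P x by rewrite PE => i; have := xP (lift ord0 i); rewrite liftK.
split=> // y Py; apply: (le_trans (fmax y Py)).
by have := xP ord0; rewrite unlift_none dotNl lerN2.
Qed.

End BorelVectors.

Lemma Rintegral_sum d (T : measurableType d) (R : realType)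
    (mu : {measure set T -> \bar R}) (D : set T) (I : Type) (s : seq I)
    (h : I -> T -> R) : measurable D ->
    (forall i, mu.-integrable D (EFin \o h i)) ->
  \int[mu]_(x in D) (\sum_(i <- s) h i x) =
  \sum_(i <- s) \int[mu]_(x in D) h i x.
Proof.
move=> mD hi; elim: s => [|i s IHs].
  by rewrite big_nil; under eq_Rintegral do rewrite big_nil;
    rewrite Rintegral_cst// mul0r.
rewrite big_cons -IHs -RintegralD//.
  by apply: eq_Rintegral => x _; rewrite big_cons.
have := integrable_sum mD s (P := xpredT) (fun i _ => hi i).
by apply: eq_integrable => // x _; rewrite /= sumEFin.
Qed.

(** * Integrability, atoms and means in an exponential family *)

Section ExponentialFamily.
Variables (R : realType) (k : nat).
Variable nu : {measure set (borel_rV R k) -> \bar R}.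
Implicit Types (Theta A F : set 'rV[R]_k) (theta u x : 'rV[R]_k).

Notation partition A theta := (\int[nu]_(x in A) expR (dot x theta)).

Lemma atom_le_integral A (f : 'rV[R]_k -> R) x :
  measurable (A : set (borel_rV R k)) -> A x -> (forall y, A y -> 0 <= f y) ->
  measurable_fun (A : set (borel_rV R k)) f ->
  ((f x)%:E * nu [set x] <= \int[nu]_(y in A) (f y)%:E)%E.
Proof.
move=> mA Ax f0 mf; rewrite -(integral_cst nu (measurable_set1_rV x)).
have -> : (\int[nu]_(y in [set x]) cst (f x)%:E y =
    \int[nu]_(y in [set x]) (f y)%:E)%E by apply: eq_integral => y /set_mem ->.
apply: ge0_subset_integral => //; first exact: measurable_set1_rV.
- exact/measurable_EFinP.
- by move=> y ->.
Qed.

Lemma integrable_expR_dot theta : natural_parameters nu theta ->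
  nu.-integrable setT (EFin \o (fun x => expR (dot x theta))).
Proof.
move=> fin; apply/integrableP; split.
  by apply/measurable_EFinP; exact: measurable_expR_dot.
by under eq_integral do rewrite /= ger0_norm ?expR_ge0//.
Qed.

Section Family.
Variable Theta : set 'rV[R]_k.
Hypothesis hfam : discrete_exponential_family nu Theta.

Lemma integrable_exp theta : Theta theta ->
  nu.-integrable setT (EFin \o (fun x => expR (dot x theta))).
Proof. by move=> /(Theta_natural hfam); exact: integrable_expR_dot. Qed.

Lemma Theta_segment theta u : Theta theta ->
  exists2 e : R, 0 < e & Theta (theta + e *: u) /\ Theta (theta - e *: u).
Proof.
move=> th; have near_th : nbhs theta Theta.
  by apply: open_nbhs_nbhs; split=> //; exact: Theta_open hfam.
have near_line v : \forall e \near (0 : R)^'+, Theta (theta + e *: v).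
  suff line_cvg : (theta + e *: v) @[e --> (0 : R)^'+] --> theta.
    exact: line_cvg _ near_th.
  apply: cvg_at_right_filter.
  suff : (theta + e *: v) @[e --> (0 : R)] --> theta + 0 *: v.
    by rewrite scale0r addr0.
  by apply: cvgD; [exact: cvg_cst | apply: cvgZr_tmp; exact: cvg_id].
have [e [e0 [eP eN]]] := filter_ex (filterI (nbhs_right_gt (0 : R))
  (filterI (near_line u) (near_line (- u)))).
by exists e => //; split; rewrite // -scalerN.
Qed.

(* [e |s| <= expR (e s) + expR (- e s)], and both exponentials are absorbed by
   moving [theta] inside the open set [Theta]. *)
Lemma integrable_dot theta u : Theta theta ->
  nu.-integrable setT (EFin \o (fun x => dot x u * expR (dot x theta))).
Proof.
move=> th; have [e e0 [thP thN]] := Theta_segment u th.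
have int2 := integrableD measurableT (integrable_exp thP) (integrable_exp thN).
apply: le_integrable (integrableZl measurableT e^-1 int2) => //.
  apply/measurable_EFinP; apply: measurable_funM; first exact: measurable_dot.
  exact: measurable_expR_dot.
move=> x _; rewrite /= lee_fin.
rewrite (ger0_norm (_ : 0 <= e^-1 * _)); last first.
  by rewrite mulr_ge0 ?addr_ge0 ?expR_ge0// invr_ge0 ltW.
rewrite normrM (ger0_norm (expR_ge0 _)) ler_pdivlMl// mulrA.
rewrite !dotDr dotNr !expRD -mulrDr mulrC ler_pM2l ?expR_gt0// dotZr.
rewrite -{1}(gtr0_norm e0) -normrM; set s := e * _.
have : 1 + `|s| <= expR `|s| by exact: expR_ge1Dx.
have [s0|s0] := leP 0 s.
  rewrite ger0_norm// => h; have := expR_ge0 (- s); lra.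
rewrite ltr0_norm// => h; have := expR_ge0 s; lra.
Qed.

Lemma integrable_coord theta i : Theta theta ->
  nu.-integrable setT (EFin \o (fun x => x 0 i * expR (dot x theta))).
Proof.
by move=> /(integrable_dot (delta_mx 0 i)); apply: eq_integrable => // x _;
  rewrite /= dot_delta.
Qed.

(** The point is finiteness: an atom of infinite mass would make the integral of
    [expR (dot y theta)] infinite for [theta] in [Theta]. *)
Lemma atom_fine_gt0 x : atoms nu x -> 0 < fine (nu [set x]).
Proof.
move=> x0; have [theta th] := Theta_nonempty hfam.
apply: fine_gt0; rewrite x0 /=.
have := atom_le_integral (f := fun y => expR (dot y theta)) measurableT
  (I : setT x) (fun y _ => expR_ge0 _) (measurable_expR_dot theta).
move=> /le_lt_trans/(_ (Theta_natural hfam th)).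
case: (nu [set x]) x0 => [r _ _|_|//]; first exact: ltry.
by rewrite gt0_muley ?lte_fin ?expR_gt0.
Qed.

Lemma atom_le_Rintegral A (f : 'rV[R]_k -> R) x :
  measurable (A : set (borel_rV R k)) -> A x -> atoms nu x ->
  (forall y, A y -> 0 <= f y) -> nu.-integrable A (EFin \o f) ->
  f x * fine (nu [set x]) <= \int[nu]_(y in A) f y.
Proof.
move=> mA Ax x0 f0 intf; have mf := measurable_int _ intf.
have nux : (nu [set x] \is a fin_num).
  have := atom_fine_gt0 x0; case: (nu [set x]) => [r| |]//=; rewrite ltxx//.
rewrite -lee_fin EFinM fineK// /Rintegral fineK; last first.
  exact: integrable_fin_num.
by apply: atom_le_integral => //; apply/measurable_EFinP.
Qed.

Lemma atom_Rintegral_gt0 A (f : 'rV[R]_k -> R) x :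
  measurable (A : set (borel_rV R k)) -> A x -> atoms nu x ->
  (forall y, A y -> 0 <= f y) -> nu.-integrable A (EFin \o f) ->
  0 < f x -> 0 < \int[nu]_(y in A) f y.
Proof.
move=> mA Ax x0 f0 intf fx.
apply: lt_le_trans (atom_le_Rintegral mA Ax x0 f0 intf).
by rewrite mulr_gt0// atom_fine_gt0.
Qed.

Lemma partition_gt0 A theta x :
  measurable (A : set (borel_rV R k)) -> A x -> atoms nu x -> Theta theta ->
  0 < partition A theta.
Proof.
move=> mA Ax x0 th; apply: (atom_Rintegral_gt0 mA Ax x0).
- by move=> y _; exact: expR_ge0.
- by apply: integrableS (integrable_exp th).
- exact: expR_gt0.
Qed.

Lemma densityE A theta x : 0 < partition A theta -> A x ->
  density nu A theta x = expR (dot x theta) / partition A theta.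
Proof.
by move=> Z0 Ax; rewrite /density mem_set// expRB /log_partition lnK.
Qed.

Lemma meanE A theta i :
  measurable (A : set (borel_rV R k)) -> Theta theta -> 0 < partition A theta ->
  mean nu A theta 0 i =
  (\int[nu]_(x in A) (x 0 i * expR (dot x theta))) / partition A theta.
Proof.
move=> mA th Z0; rewrite mxE -RintegralZr//; last first.
  by apply: integrableS (integrable_coord i th).
by apply: eq_Rintegral => x /set_mem Ax; rewrite densityE// mulrA.
Qed.

Lemma dot_mean A theta u :
  measurable (A : set (borel_rV R k)) -> Theta theta -> 0 < partition A theta ->
  dot (mean nu A theta) u * partition A theta =
  \int[nu]_(x in A) (dot x u * expR (dot x theta)).
Proof.
move=> mA th Z0; rewrite mulr_suml.
under eq_bigr => i _ do
  rewrite meanE// mulrAC divfK ?gt_eqF// -RintegralZr//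
    ?(integrableS measurableT mA _ (integrable_coord i th))//.
rewrite -Rintegral_sum//.
  by apply: eq_Rintegral => x _; rewrite mulr_suml; apply: eq_bigr => i _;
    rewrite mulrAC.
move=> i; apply: (integrableS measurableT) => //.
have := integrableZr measurableT (u 0 i) (integrable_coord i th).
by apply: eq_integrable.
Qed.

End Family.
End ExponentialFamily.

(** * Relative interior of a face and Jensen's inequality *)

Section Family.
Variables (R : realType) (k : nat).
Variable nu : {measure set (borel_rV R k) -> \bar R}.
Variable Theta : set 'rV[R]_k.
Hypothesis hfam : discrete_exponential_family nu Theta.
Implicit Types (A F S K : set 'rV[R]_k) (theta u x : 'rV[R]_k).

Notation partition A theta := (\int[nu]_(x in A) expR (dot x theta)).
Notation P := (convex_support nu).

(** The slack of a constraint at the mean is the average of its slack over [F]. If it is positive at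
    some atom of [S], it is positive at the mean, hence nearby; otherwise the constraint is an
    equality on [S], hence on the affine hull of [F]. Either way it holds at points of the affine
    hull near the mean. *)
Lemma mean_relint F S theta :
  polyhedron F -> F !=set0 -> S `<=` atoms nu -> F = convex_hull S ->
  Theta theta -> relint F (mean nu F theta).
Proof.
move=> polF [f Ff] Sat FS th; have SF : S `<=` F.
  by rewrite FS; exact: sub_convex_hull.
have mF : measurable (F : set (borel_rV R k)).
  by apply: closed_measurable_rV; exact: polyhedron_closed.
(* The zero form serves only to extract an element of [S]. *)
have [s0 Ss0 _] : exists2 s, S s & dot 0 f <= dot 0 s.
  by apply: convex_hull_dot_le; rewrite -FS.
have Z0 := partition_gt0 hfam mF (SF _ Ss0) (Sat _ Ss0) th.
have [m [a [b FE]]] := polF.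
have inF x : (forall i, dot (a i) x <= b i) -> F x by move=> ?; rewrite FE.
have Fle x i : F x -> dot x (a i) <= b i.
  by move=> Fx; move: Fx; rewrite FE dotC; exact.
have slackE i : (b i - dot (mean nu F theta) (a i)) * partition F theta =
    \int[nu]_(x in F) ((b i - dot x (a i)) * expR (dot x theta)).
  rewrite mulrBl (dot_mean hfam)// -RintegralZl//; last first.
    by apply: integrableS (integrable_exp hfam th).
  rewrite -RintegralB//; first by apply: eq_Rintegral => x _; rewrite mulrBl.
    apply: (integrableS measurableT) => //.
    have := integrableZl measurableT (b i) (integrable_exp hfam th).
    by apply: eq_integrable.
  by apply: integrableS (integrable_dot hfam (a i) th).
have slack_int i : nu.-integrable F
    (EFin \o (fun x => (b i - dot x (a i)) * expR (dot x theta))).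
  apply: (integrableS measurableT) => //.
  have := integrableB measurableT
    (integrableZl measurableT (b i) (integrable_exp hfam th))
    (integrable_dot hfam (a i) th).
  by apply: eq_integrable => // x _; rewrite /= mulrBl EFinB EFinM.
have meanF : F (mean nu F theta).
  apply: inF => i; rewrite dotC -subr_ge0 -(pmulr_lge0 _ Z0) slackE.
  apply: Rintegral_ge0 => x Fx.
  by rewrite mulr_ge0 ?expR_ge0// subr_ge0 Fle.
split=> //.
have near_le i :
    \forall y \near mean nu F theta, affine_hull F y -> dot (a i) y <= b i.
  have [[s Ss sb]|tight] := pselect (exists2 s, S s & dot s (a i) < b i).
    have : dot (a i) (mean nu F theta) < b i.
      rewrite dotC -subr_gt0 -(pmulr_lgt0 _ Z0) slackE.
      apply: (atom_Rintegral_gt0 hfam mF (SF _ Ss) (Sat _ Ss)) => //.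
        by move=> x Fx; rewrite mulr_ge0 ?expR_ge0// subr_ge0 Fle.
      by rewrite mulr_gt0 ?expR_gt0// subr_gt0.
    move=> /(cvgr_lt _ (@dot_continuousr _ _ (a i) _)).
    by apply: filterS => y /ltW.
  apply: (@nearW _ (nbhs (mean nu F theta))) => y Fy.
  rewrite (affine_hull_dot_eq (b := b i) _ Fy)// => x Fx.
  apply: (@affine_hull_dot_eq _ _ S); last first.
    by apply: convex_hull_affine; rewrite -FS.
  move=> s Ss; apply/eqP; rewrite dotC eq_le (Fle _ _ (SF _ Ss)) /= leNgt.
  by apply/negP => ?; apply: tight; exists s.
near=> y => Fy; apply: inF => i; move: i Fy; near: y.
exact: filter_forall near_le.
Unshelve. all: by end_near. Qed.

(** A null set contains no point of positive mass. *)
Lemma ae_atom (Q : 'rV[R]_k -> Prop) x :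
  {ae nu, forall y, Q y} -> atoms nu x -> Q x.
Proof.
move=> [B [mB B0 QB]] x0; apply: contrapT => nQx.
have := x0; rewrite /atoms /= (subset_measure0 _ mB _ B0) ?ltxx//.
  exact: measurable_set1_rV.
by move=> y ->; exact: QB.
Qed.

Lemma density_ratio theta s t :
  density nu setT theta t =
  density nu setT theta s * expR (dot (t - s) theta).
Proof.
rewrite /density !mem_set// -expRD; congr expR.
by rewrite dotBl; ring.
Qed.

(* Jensen's inequality, from [1 + t <= expR t]. *)
Lemma partition_mean_le theta theta' : Theta theta -> Theta theta' ->
  0 < partition setT theta ->
  partition setT theta * expR (dot (mean nu setT theta) (theta' - theta)) <=
  partition setT theta'.
Proof.
move=> th th' Z0; set mu := mean _ _ _; set u := theta' - theta.
have int1 := integrable_exp hfam th; have intu := integrable_dot hfam u th.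
have intZ := integrableZl measurableT (1 - dot mu u) int1.
have int2 := integrableZl measurableT (expR (dot mu u))
  (integrableD measurableT intZ intu).
(* The integrand is the tangent of the exponential at [dot mu u], evaluated at [dot x u] and
   weighted by [expR (dot x theta)]. Its linear term integrates to 0 because [mu] is the mean. *)
have -> : partition setT theta * expR (dot mu u) = \int[nu]_x
    (expR (dot mu u) *
      ((1 - dot mu u) * expR (dot x theta) + dot x u * expR (dot x theta))).
  rewrite RintegralZl//; last exact: (integrableD measurableT intZ intu).
  rewrite RintegralD// RintegralZl// -(dot_mean hfam)// -/mu.
  by rewrite -mulrDl subrK mul1r mulrC.
apply: le_Rintegral => //; first exact: (integrable_exp hfam th').
move=> x _; rewrite -mulrDl.
have -> : dot x theta' = dot mu u + ((dot x u - dot mu u) + dot x theta).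
  by rewrite addrA subrKC /u dotBr subrK.
rewrite !expRD ler_pM2l ?expR_gt0// ler_pM2r ?expR_gt0//.
by rewrite -expRD addrAC -addrA expR_ge1Dx.
Qed.

End Family.

(** The point [c] is a cluster point of [d] along [within A \oo], a proper filter because [A] holds
    infinitely often. The double negation expresses that [d n] enters [N] for infinitely many [n] in
    [A]. *)
Lemma compact_frequently (T : topologicalType) (K : set T) (d : nat -> T)
    (A : set nat) :
  compact K -> (forall n, K (d n)) -> ~ (\forall n \near \oo, ~ A n) ->
  exists2 c, K c &
    forall N, nbhs c N -> ~ (\forall n \near \oo, A n -> ~ N (d n)).
Proof.
move=> cK Kd freqA.
have FF : ProperFilter (within A \oo).
  by split; [exact: freqA | exact: within_filter].
have FK : (d @ within A \oo) K.
  exact: (@filterE _ (within A \oo) _ (d @^-1` K) Kd).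
have [c [Kc clc]] := cK _ _ FK.
exists c => // N Nc evN; have [y [nNy Ny]] := clc (~` N) N evN Nc.
exact: nNy.
Qed.

Lemma cvg_rV (R : realType) (k : nat) (u : nat -> 'rV[R]_k) (l : 'rV[R]_k) :
  (forall i, (fun n => u n 0 i) @ \oo --> l 0 i) -> u @ \oo --> l.
Proof.
move=> ul; apply/cvg_ballP => e e0.
have near_ball i : \forall n \near \oo, ball (l 0 i) e (u n 0 i).
  by have /cvg_ballP/(_ e e0) := ul i.
near=> n; split=> // i j; rewrite (ord1 i); move: j; near: n.
exact: filter_forall near_ball.
Unshelve. all: by end_near. Qed.

(** * Limits along the sequence [eta + rho n *: d n] *)

Section FaceLimits.
Variables (R : realType) (k : nat).
Variable nu : {measure set (borel_rV R k) -> \bar R}.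
Variables (Theta F : set 'rV[R]_k) (theta eta : 'rV[R]_k).
Variables (theta_ d : nat -> 'rV[R]_k) (rho : nat -> R).
Hypothesis hfam : discrete_exponential_family nu Theta.
Hypothesis hF : face (convex_support nu) F.
Hypothesis htheta : Theta theta.
Hypothesis heta : parameter_class nu Theta F theta eta.
Hypothesis htheta_ : forall n, Theta (theta_ n).
Hypothesis htheta_E : forall n, theta_ n = eta + rho n *: d n.
Hypothesis hrho0 : forall n, 0 <= rho n.
Hypothesis hd : forall n, norm2 (d n) = 1.
Hypothesis hrho : rho @ \oo --> +oo.
Implicit Types (K S : set 'rV[R]_k) (x s t : 'rV[R]_k).

Notation P := (convex_support nu).
Notation partition A theta := (\int[nu]_(x in A) expR (dot x theta)).

Let face_atoms : exists2 S, S `<=` atoms nu & F = convex_hull S.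
Proof. by have [S [? ?]] := faces_convex_hull hfam hF; exists S. Qed.

Let face_sub_support : F `<=` P.
Proof. by have [_ [c ->]] := hF; move=> x []. Qed.

Lemma support_nonempty : P !=set0.
Proof. by have [[f /face_sub_support Pf] _] := hF; exists f. Qed.

Let face_closed : closed F.
Proof.
apply: polyhedron_closed; apply: polyhedron_face hF.
exact: convex_support_polyhedron hfam.
Qed.

Let face_measurable : measurable (F : set (borel_rV R k)).
Proof. exact: closed_measurable_rV face_closed. Qed.

Let Theta_eta : Theta eta. Proof. by have [] := heta. Qed.

(** The polyhedron is a face of itself, so the assumption on faces covers it. *)
Lemma support_atoms : exists2 S, S `<=` atoms nu & P = convex_hull S.
Proof.
have [S [? ?]] := faces_convex_hull hfam (face_improper support_nonempty).
by exists S.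
Qed.

Let face_atom : exists2 s, atoms nu s & F s.
Proof.
have [[f Ff] _] := hF; have [S Sat FS] := face_atoms.
have [s Ss _] : exists2 s, S s & dot 0 f <= dot 0 s.
  by apply: convex_hull_dot_le; rewrite -FS.
by exists s; [exact: Sat | rewrite FS; exact: sub_convex_hull].
Qed.

Let partitionT_gt0 theta' : Theta theta' -> 0 < partition setT theta'.
Proof.
have [s s0 _] := face_atom.
by move=> th; exact: (partition_gt0 hfam measurableT (I : setT s)).
Qed.

Let partitionF_gt0 theta' : Theta theta' -> 0 < partition F theta'.
Proof.
by have [s s0 Fs] := face_atom => th; exact: (partition_gt0 hfam _ Fs).
Qed.

(** Jensen's inequality compares [theta_ n] with [eta]; the partition function at [theta_ n] is then
    bounded below by its term at [x], and [dot (d n)] of the mean is bounded above by the norm of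
    the mean. As [rho n] grows, the norm cannot stay below [dot (d n) x] by a fixed margin. *)
Lemma atom_mean_bound x n : atoms nu x ->
  expR (dot x eta + rho n * (dot (d n) x - norm2 (mean nu setT (theta_ n)))) *
    fine (nu [set x]) <= partition setT eta.
Proof.
move=> x0; have Z0 := partitionT_gt0 (htheta_ n).
apply: le_trans (partition_mean_le hfam (htheta_ n) Theta_eta Z0).
have : expR (dot x (theta_ n)) * fine (nu [set x]) <= partition setT (theta_ n).
  apply: (atom_le_Rintegral (f := fun y => expR (dot y (theta_ n))) hfam) => //.
  exact: (integrable_exp hfam (htheta_ n)).
move=> /(ler_wpM2r (expR_ge0 (dot (mean nu setT (theta_ n)) (eta - theta_ n)))).
apply: le_trans; rewrite mulrAC -expRD ler_pM2r ?(atom_fine_gt0 hfam)//.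
rewrite ler_expR htheta_E opprD addNKr dotNr dotDr !dotZr -addrA lerD2l.
rewrite -mulrBr ler_wpM2l// (dotC x) lerD2l lerN2 dotC.
exact: dot_unit_le.
Qed.

Lemma diverging_mean K : compact K ->
  K `<=` ~` (\bigcup_(G in face P) normal_cone P G) -> (forall n, K (d n)) ->
  (fun n => norm2 (mean nu setT (theta_ n))) @ \oo --> +oo.
Proof.
move=> cK KN Kd; apply/cvgryPgt => L; apply: contrapT => freq.
have [|c Kc freqc] := @compact_frequently _ K d
    [set n | norm2 (mean nu setT (theta_ n)) <= L] cK Kd.
  move=> ev; apply: freq; near=> n; rewrite ltNge; apply/negP.
  by near: n; exact: ev.
(* Otherwise the cluster direction [c] is bounded on [P], so it attains its maximum there and lies
   in the normal cone of the face of its maximizers. *)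
have [x x0 cx] : exists2 x, atoms nu x & L + 1 < dot c x.
  apply: contrapT => nx.
  have [S Sat PS] := support_atoms.
  have cP y : P y -> dot c y <= L + 1.
    rewrite PS => /(convex_hull_dot_le c)[s Ss /le_trans]; apply.
    by rewrite leNgt; apply/negP => ?; apply: nx; exists s => //; exact: Sat.
  have [y ymax] := polyhedron_attains_max (convex_support_polyhedron hfam)
    support_nonempty cP.
  apply: (KN _ Kc); exists (argmax_set P c) => //.
  by split; [exists y | exists c].
apply: (freqc [set c' | L + 1 < dot c' x]).
  exact: (cvgr_gt _ (@dot_continuousl _ _ x c)).
(* When [norm2] of the mean is at most [L] and [dot (d n) x] exceeds [L + 1], the margin is at least
   1, so [atom_mean_bound] yields [rho n <= expR (rho n) <= B]. *)
pose B := partition setT eta / (expR (dot x eta) * fine (nu [set x])).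
have hrhoB : \forall n \near \oo, B < rho n by move/cvgryPgt: hrho; exact.
near=> n => /= muL dx; have : B < rho n by near: n.
apply/negP; rewrite -leNgt.
have C0 : 0 < expR (dot x eta) * fine (nu [set x]).
  by rewrite mulr_gt0 ?expR_gt0 ?(atom_fine_gt0 hfam).
rewrite ler_pdivlMr//; apply: le_trans (atom_mean_bound n x0).
rewrite expRD [leRHS]mulrAC (mulrC (rho n)) ler_pM2l//.
apply: le_trans (_ : expR (rho n) <= _).
  by apply: le_trans (expR_ge1Dx _); rewrite lerDr.
by rewrite ler_expR ler_peMr// lerBrDr (le_trans _ (ltW dx))// addrC lerD2r.
Unshelve. all: by end_near. Qed.

Lemma not_converges_to_face K : compact K -> K `<=` ~` normal_cone P F ->
  (forall n, K (d n)) -> ~ converges_to_face nu F theta theta_.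
Proof.
move=> cK KN Kd [cvg_p _ _].
have [|c Kc freqc] := @compact_frequently _ K d setT cK Kd.
  by move=> /filter_ex[n]; apply.
have [x [y [Fx Py cxy]]] := normal_coneP face_sub_support (KN _ Kc).
have [S Sat FS] := face_atoms; have [S' S'at PS'] := support_atoms.
have [s Ss cs] : exists2 s, S s & dot c s <= dot c x.
  by apply: convex_hull_dot_ge; rewrite -FS.
have [t St ct] : exists2 t, S' t & dot c y <= dot c t.
  by apply: convex_hull_dot_le; rewrite -PS'.
have cst : 0 < dot c (t - s).
  by rewrite dotBr subr_gt0 (le_lt_trans cs)// (lt_le_trans cxy).
have Fs : F s by rewrite FS; exact: sub_convex_hull.
have cvg_s := ae_atom cvg_p (Sat _ Ss).
have cvg_t := ae_atom cvg_p (S'at _ St).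
set ps := density nu F theta s in cvg_s.
set pt := density nu F theta t in cvg_t.
have ps0 : 0 < ps by rewrite /ps /density mem_set// expR_gt0.
clearbody ps pt.
apply: (freqc [set c' | dot c (t - s) / 2 < dot c' (t - s)]).
  by apply: (cvgr_gt _ (@dot_continuousl _ _ (t - s) c)); lra.
(* Beyond [B], the exponent [dot (t - s) eta + rho n * (dot c (t - s) / 2)] exceeds
   [(pt + 1) / (ps / 2)]. With a density above [ps / 2] at [s], this pushes the density at [t] past
   [pt + 1]. *)
pose B := ((pt + 1) / (ps / 2) - dot (t - s) eta) / (dot c (t - s) / 2).
have hrhoB : \forall n \near \oo, B < rho n by move/cvgryPgt: hrho; exact.
near=> n => _ /= dn.
have : B < rho n by near: n.
have psn : ps / 2 < density nu setT (theta_ n) s.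
  by near: n; apply: (cvgr_gt _ cvg_s); lra.
have : density nu setT (theta_ n) t < pt + 1.
  by near: n; apply: (cvgr_lt _ cvg_t); lra.
rewrite (density_ratio _ _ s t) => ptn.
have ps20 : 0 < ps / 2 by rewrite divr_gt0.
rewrite ltr_pdivrMr ?divr_gt0// ltNge; apply/negP; rewrite negbK lerBrDr.
rewrite ler_pdivlMr//; apply: le_trans (ltW ptn).
rewrite [leRHS]mulrC.
apply: le_trans (ler_wpM2l (expR_ge0 _) (ltW psn)); rewrite ler_pM2r//.
apply: le_trans (expR_ge1Dx _).
rewrite htheta_E (dotDr (t - s) eta) dotZr addrC.
apply: ler_wpDl => //; rewrite lerD2l; apply: ler_wpM2l => //.
by rewrite (dotC _ (d n)) ltW.
Unshelve. all: by end_near. Qed.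

(** Both points maximize every vector of the normal cone, so each such vector, and any linear
    combination of them, is constant on [F]. *)
Lemma span_normal_cone_const zeta x y :
  linear_span (normal_cone P F) zeta -> F x -> F y -> dot x zeta = dot y zeta.
Proof.
move=> [m [a [v [Nv ->]]]] Fx Fy; rewrite !dot_sumr; apply: eq_bigr => i _.
rewrite !dotZr !(dotC _ (v i)); congr (_ * _); apply/eqP.
have [Px xmax] := Nv i x Fx; have [Py ymax] := Nv i y Fy.
by rewrite eq_le ymax// xmax.
Qed.

(** On [F], passing from [theta] to [eta] multiplies every weight by the constant
    [expR (dot f zeta)], which cancels on normalization. *)
Lemma density_class : density nu F theta = density nu F eta.
Proof.
have [_ [zeta [span etaE]]] := heta; have [[f Ff] _] := hF.
have expE y : F y ->
    expR (dot y eta) = expR (dot f zeta) * expR (dot y theta).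
  move=> Fy; rewrite etaE dotDr expRD mulrC.
  by rewrite (span_normal_cone_const span Fy Ff).
have partE : partition F eta = expR (dot f zeta) * partition F theta.
  rewrite -RintegralZl//; last first.
    exact: (integrableS measurableT face_measurable _
      (integrable_exp hfam htheta)).
  by apply: eq_Rintegral => y /set_mem; exact: expE.
apply/funext => x; have [Fx|nFx] := pselect (F x); last first.
  by rewrite /density memNset.
rewrite (densityE (partitionF_gt0 htheta) Fx).
rewrite (densityE (partitionF_gt0 Theta_eta) Fx) partE expE//.
by rewrite -mulf_div divff ?mul1r// gt_eqF// expR_gt0.
Qed.

(** * Directions in the relative interior of the normal cone *)

Section RelativeInterior.
Variable K : set 'rV[R]_k.
Hypothesis compactK : compact K.
Hypothesis K_relint : K `<=` relint (normal_cone P F).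
Hypothesis Kd : forall n, K (d n).
Variable f : 'rV[R]_k.
Hypothesis Ff : F f.

(* Multiplying by [shift n] turns [expR (dot x (theta_ n))] into a quantity
   that is constant on [F] and dominated by [expR (dot x eta)] on [P]. *)
Let shift n := expR (- (rho n * dot (d n) f)).

Let shiftE n x : shift n * expR (dot x (theta_ n)) =
  expR (dot x eta + rho n * dot (d n) (x - f)).
Proof.
rewrite -expRD htheta_E dotDr dotZr dotBr (dotC x (d n)); congr expR; ring.
Qed.

Let argmaxK c : K c -> argmax_set P c = F.
Proof. by move=> /K_relint; exact: relint_normal_cone_argmax. Qed.

Let argmax_le c x : K c -> P x -> dot c (x - f) <= 0.
Proof.
move=> Kc; have := Ff; rewrite -(argmaxK Kc) => -[_ fmax] /fmax.
by rewrite dotBr subr_le0.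
Qed.

Let argmax_lt c x : K c -> P x -> ~ F x -> dot c (x - f) < 0.
Proof.
move=> Kc Px nFx; rewrite ltNge; apply/negP; rewrite dotBr subr_ge0 => fx.
apply: nFx; rewrite -(argmaxK Kc); split=> // y Py; apply: le_trans fx.
by have := argmax_le Kc Py; rewrite dotBr subr_le0.
Qed.

(** On [F] the shifted weight is constant in [n]. Off [F], compactness of [K] gives a gap
    [delta > 0] with [dot (d n) (x - f) <= - delta] for all [n], and the exponent tends to minus
    infinity. *)
Let shift_cvg x : P x -> (fun n => shift n * expR (dot x (theta_ n))) @ \oo -->
  ((fun y => expR (dot y eta)) \_ F) x.
Proof.
move=> Px; rewrite patchE.
have -> : (fun n => shift n * expR (dot x (theta_ n))) =
    fun n => expR (dot x eta + rho n * dot (d n) (x - f)).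
  by apply/funext => n; exact: shiftE.
case: ifPn => [/set_mem Fx|/negP nFx].
  rewrite (_ : (fun n => _) = fun=> expR (dot x eta)); first exact: cvg_cst.
  apply/funext => n; rewrite dotBr.
  have := argmax_le (Kd n) Px; rewrite dotBr subr_le0 => xf.
  have := Fx; rewrite -(argmaxK (Kd n)) => -[_ /(_ f (face_sub_support Ff))] fx.
  by rewrite (_ : dot (d n) x = dot (d n) f) ?subrr ?mulr0 ?addr0//;
    apply/eqP; rewrite eq_le xf.
have {}nFx : ~ F x by move=> Fx; apply: nFx; exact/mem_set.
have [||c /set_mem Kc cmax] :=
    @EVT_max_rV R k (fun c => dot c (x - f)) K _ compactK.
- by exists (d 0%N).
- by apply: continuous_subspaceT; exact: dot_continuousl.
set delta := - dot c (x - f).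
have delta0 : 0 < delta by rewrite oppr_gt0 argmax_lt.
apply/cvgr0Pnorm_lt => e e0.
(* This threshold suffices because [rho n * delta <= expR (rho n * delta)]. *)
have hrhoB : \forall n \near \oo, expR (dot x eta) / e / delta < rho n.
  by move/cvgryPgt: hrho; exact.
near=> n; rewrite gtr0_norm ?expR_gt0//.
apply: (@le_lt_trans _ _ (expR (dot x eta) * expR (- (rho n * delta)))).
  rewrite -expRD ler_expR lerD2l -mulrN ler_wpM2l// opprK.
  by apply: cmax; exact/mem_set.
rewrite expRN ltr_pdivrMr ?expR_gt0// mulrC -ltr_pdivrMr//.
apply: (@lt_le_trans _ _ (rho n * delta)); last first.
  by apply: le_trans (expR_ge1Dx _); rewrite lerDr.
by rewrite -ltr_pdivrMr//; near: n.
Unshelve. all: by end_near. Qed.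

Let ae_support : {ae nu, forall x, P x}.
Proof.
exists (~` supp nu); split.
- by apply: measurableC; apply: closed_measurable_rV; exact: closed_closure.
- exact: nu_concentrated hfam.
- move=> x nPx sx; apply: nPx.
  by apply: subset_closure; exact: sub_convex_hull.
Qed.

(** Dominated convergence with bound [|h x| * expR (dot x eta)], valid on [P] since
    [rho n * dot (d n) (x - f) <= 0] there. Taking [h] constant 1 gives the normalizing constants,
    and [h] a coordinate the numerators of the means. *)
Let shift_integral_cvg (h : 'rV[R]_k -> R) :
  (forall theta', Theta theta' ->
    nu.-integrable setT (EFin \o (fun x => h x * expR (dot x theta')))) ->
  (fun n => shift n * \int[nu]_x (h x * expR (dot x (theta_ n)))) @ \oo -->
  \int[nu]_(x in F) (h x * expR (dot x eta)).
Proof.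
move=> inth; pose g n x := h x * (shift n * expR (dot x (theta_ n))).
pose g_lim := (fun x => h x * expR (dot x eta)) \_ F.
have mg n : measurable_fun [set: borel_rV R k] (g n).
  have := integrableZl measurableT (shift n) (inth _ (htheta_ n)).
  move=> /measurable_int/measurable_EFinP; apply: eq_measurable_fun => x _.
  by rewrite /g mulrCA.
have mlim : measurable_fun [set: borel_rV R k] g_lim.
  apply/(measurable_restrictT _ face_measurable)/measurable_funTS.
  by have /measurable_int/measurable_EFinP := inth _ Theta_eta.
have int_eta := inth _ Theta_eta.
have [|||||_ _ lim] := @dominated_convergence _ _ _ nu setT measurableT
    (fun n => EFin \o g n) (EFin \o g_lim)
    (abse \o (EFin \o (fun x => h x * expR (dot x eta)))).
- by move=> n; exact/measurable_EFinP.
- exact/measurable_EFinP.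
- apply: (@filterS _ (almost_everywhere nu) _ P _ _ ae_support) => x Px _.
  apply: cvg_EFin.
    by apply: nearW.
  rewrite (_ : g_lim x = h x * ((fun y => expR (dot y eta)) \_ F) x).
    exact: cvgM (cvg_cst (h x)) (shift_cvg Px).
  by rewrite /g_lim !patchE; case: ifP => _; rewrite ?mulr0.
- exact: integrable_abse.
- apply: (@filterS _ (almost_everywhere nu) _ P _ _ ae_support) => x Px n _ /=.
  rewrite lee_fin /g shiftE !normrM; apply: ler_wpM2l => //.
  rewrite !ger0_norm ?expR_ge0// ler_expR gerDl.
  by rewrite mulr_ge0_le0// argmax_le.
rewrite Rintegral_mkcond -/g_lim.
have -> : (fun n => shift n * \int[nu]_x (h x * expR (dot x (theta_ n)))) =
    fine \o (fun n => \int[nu]_x (EFin \o g n) x)%E.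
  apply/funext => n; rewrite -RintegralZl//; last exact: inth.
  by congr fine; apply: eq_integral => x _; rewrite /= /g mulrCA.
apply: fine_cvg; rewrite fineK//.
apply: integrable_fin_num => //.
apply: (le_integrable measurableT _ _ int_eta).
  exact/measurable_EFinP.
move=> x _; rewrite lee_fin /g_lim patchE; case: ifPn => // _.
by rewrite normr0.
Qed.

(** Densities and means are quotients in which [shift n] cancels, so numerators and denominators
    converge separately. The limits appear at [eta] and [density_class] carries them to [theta]. *)
Lemma relint_converges_to_face : converges_to_face nu F theta theta_.
Proof.
have shift_cancel n (a b : R) : shift n * a / (shift n * b) = a / b.
  by rewrite -mulf_div divff ?mul1r// gt_eqF// expR_gt0.
have shift_partition_cvg :
    (fun n => shift n * partition setT (theta_ n)) @ \oo --> partition F eta.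
  have mul1 A theta' :
      \int[nu]_(x in A) (1 * expR (dot x theta')) = partition A theta'.
    by apply: eq_Rintegral => x _; rewrite mul1r.
  have /= := @shift_integral_cvg (fun=> 1).
  rewrite mul1; under eq_fun do rewrite mul1.
  apply=> theta' /(integrable_exp hfam); apply: eq_integrable => // x _.
  by rewrite /= mul1r.
have ZF0 : partition F eta != 0 by rewrite gt_eqF// partitionF_gt0.
have meanFE : mean nu F theta = mean nu F eta by rewrite /mean density_class.
split.
- apply: (@filterS _ (almost_everywhere nu) _ P _ _ ae_support) => x Px.
  rewrite density_class.
  have -> : density nu F eta x =
      ((fun y => expR (dot y eta)) \_ F) x / partition F eta.
    rewrite patchE; case: ifPn => [/set_mem Fx|nFx].
      exact: densityE (partitionF_gt0 Theta_eta) Fx.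
    by rewrite /density (negbTE nFx) mul0r.
  have -> : (fun n => density nu setT (theta_ n) x) = (fun n =>
      shift n * expR (dot x (theta_ n)) /
      (shift n * partition setT (theta_ n))).
    apply/funext => n.
    rewrite (densityE (partitionT_gt0 (htheta_ n)) (I : setT x)).
    by rewrite shift_cancel.
  exact: cvgM (shift_cvg Px) (cvgV ZF0 shift_partition_cvg).
- apply: cvg_rV => i; rewrite meanFE.
  have -> : (fun n => mean nu setT (theta_ n) 0 i) = (fun n =>
      shift n * (\int[nu]_x (x 0 i * expR (dot x (theta_ n)))) /
      (shift n * partition setT (theta_ n))).
    apply/funext => n; rewrite shift_cancel.
    exact: (meanE hfam i measurableT (htheta_ n) (partitionT_gt0 (htheta_ n))).
  rewrite (meanE hfam i face_measurable Theta_eta (partitionF_gt0 Theta_eta)).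
  apply: cvgM (cvgV ZF0 shift_partition_cvg).
  apply: shift_integral_cvg => theta' th'; exact: (integrable_coord hfam i th').
- have [S Sat FS] := face_atoms.
  have polF := polyhedron_face (convex_support_polyhedron hfam) hF.
  exact: (mean_relint hfam polF (ex_intro _ f Ff) Sat FS htheta).
Qed.

End RelativeInterior.

End FaceLimits.

Theorem theorem2p4 (R : realType) (k : nat)
    (nu : {measure set (borel_rV R k) -> \bar R})
    (Theta F : set 'rV[R]_k) (theta eta : 'rV[R]_k)
    (theta_ d : nat -> 'rV[R]_k) (rho : nat -> R)
    (hfam : discrete_exponential_family nu Theta)
    (hF : face (convex_support nu) F)
    (htheta : Theta theta)
    (heta : parameter_class nu Theta F theta eta)
    (htheta_ : forall n, Theta (theta_ n))
    (htheta_E : forall n, theta_ n = eta + rho n *: d n)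
    (hrho0 : forall n, 0 <= rho n)
    (hrho : rho @ \oo --> +oo)
    (hd : forall n, norm2 (d n) = 1) :
  [/\ forall K : set 'rV[R]_k, compact K ->
        K `<=` relint (normal_cone (convex_support nu) F) ->
        (forall n, K (d n)) ->
        converges_to_face nu F theta theta_,
      forall K : set 'rV[R]_k, compact K ->
        K `<=` ~` normal_cone (convex_support nu) F ->
        (forall n, K (d n)) ->
        ~ converges_to_face nu F theta theta_
    & forall K : set 'rV[R]_k, compact K ->
        K `<=` ~` (\bigcup_(G in face (convex_support nu))
                     normal_cone (convex_support nu) G) ->
        (forall n, K (d n)) ->
        norm2 (mean nu setT (theta_ n)) @[n --> \oo] --> +oo /\
        ~ converges_to_face nu F theta theta_].
Proof.
split=> K cK KN Kd.
- have [[f Ff] _] := hF.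
  exact: (relint_converges_to_face hfam hF htheta heta htheta_ htheta_E hrho0
    hrho cK KN Kd Ff).
- exact: (not_converges_to_face hfam hF htheta_E hrho0 hrho cK KN Kd).
- split.
    exact: (diverging_mean hfam hF heta htheta_ htheta_E hrho0 hd hrho cK
      KN Kd).
  (* A direction outside all normal cones is outside that of [F], so failure of convergence comes
     from the second claim. *)
  apply: (not_converges_to_face hfam hF htheta_E hrho0 hrho cK _ Kd).
  by move=> c /KN nNc NFc; apply: nNc; exists F.
Qed.
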